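(* Suppose that the full system with disturbance $\dot z=f(z,u,d)$, $z=(z_1,z_2,z_c)$, decomposes into the form $\dot z_1=f_1(z_1,z_c,u,d)$, $\dot z_2=f_2(z_2,z_c,u,d)$, $\dot z_c=f_c(z_c,u,d)$. Let $t<0$. If the target sets satisfy $\mathcal T=\mathrm{proj}_1^{-1}(\mathcal T_1)\cap \mathrm{proj}_2^{-1}(\mathcal T_2)$, then the minimal backward reachable sets satisfy $$\mathcal A(t)\subseteq\mathrm{proj}_1^{-1}(\mathcal A_1(t))\cap \mathrm{proj}_2^{-1}(\mathcal A_2(t)).$$
   Context: System: $z\in\mathbb R^n$ evolves by $\dot z=f(z,u,d)$ on $[t,0]$, $t<0$, with control $u\in\mathcal U\subset\mathbb R^{n_u}$ ($\mathcal U$ compact) and disturbance $d\in\mathcal D\subset\mathbb R^{n_d}$ (bounded); $f$ is uniformly continuous, bounded, and Lipschitz in $z$ for fixed $(u,d)$. Control functions $u(\cdot)$ and disturbance functions $d(\cdot)$ are measurable functions from $[t,0]$ to $\mathcal U$ and $\mathcal D$. $\zeta(s;z,t,u(\cdot),d(\cdot))$ is the unique trajectory equal to $z$ at time $t$. The disturbance is given by a non-anticipative strategy $\gamma\in\Gamma(t)$: a map $u(\cdot)\mapsto\gamma[u](\cdot)$ from control functions to disturbance functions such that whenever $u(r)=\hat u(r)$ for a.e. $r\in[t,s]$, then $\gamma[u](r)=\gamma[\hat u](r)$ for a.e. $r\in[t,s]$. State partition: $z=(z_1,z_2,z_c)$ with $z_i\in\mathbb R^{n_i}$, $z_c\in\mathbb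 R^{n_c}$, $n_1,n_2>0$, $n_c\ge 0$, $n_1+n_2+n_c=n$. Subsystem states are $x_i=(z_i,z_c)$, $i=1,2$. Subsystem $i$ has dynamics $\dot z_i=f_i(z_i,z_c,u,d)$, $\dot z_c=f_c(z_c,u,d)$ with trajectory $\xi_i(s;x_i,t,u(\cdot),d(\cdot))$ equal to $x_i$ at time $t$. Back-projection: for $S_i\subseteq\mathbb R^{n_i+n_c}$, $\mathrm{proj}_i^{-1}(S_i)=\{z\in\mathbb R^n:(z_i,z_c)\in S_i\}$. Target sets: $\mathcal T\subseteq\mathbb R^n$, $\mathcal T_i\subseteq\mathbb R^{n_i+n_c}$. Minimal backward reachable sets: $\mathcal A(t)=\{z:\exists\gamma\in\Gamma(t),\ \forall u(\cdot),\ \zeta(0;z,t,u(\cdot),\gamma[u](\cdot))\in\mathcal T\}$ and $\mathcal A_i(t)=\{x_i:\exists\gamma\in\Gamma(t),\ \forall u(\cdot),\ \xi_i(0;x_i,t,u(\cdot),\gamma[u](\cdot))\in\mathcal T_i\}$. *)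

(* Defs.v *)
From HB Require Import structures.
From mathcomp Require Import all_boot all_order all_algebra.
From mathcomp Require Import all_classical all_reals all_analysis.

Set Implicit Arguments.
Unset Strict Implicit.
Unset Printing Implicit Defensive.

Import Order.TTheory GRing.Theory Num.Theory.
Import numFieldNormedType.Exports.

Local Open Scope classical_set_scope.
Local Open Scope ring_scope.

Section System.
Context {R : realType}.

(* Signals and trajectories are functions on all of R of which only the values
   on [t, 0] matter. *)

(* The sigma-algebra on R is the Borel one. Every Lebesgue measurable signal is
   a.e. equal to a Borel one, and strategies and trajectories only see signals
   up to null sets. *)
Definition signal m (t : R) (V : set 'rV[R]_m) (v : R -> 'rV[R]_m) : Prop :=
  (forall j, measurable_fun `[t, 0] (fun s => v s ord0 j)) /\
  (forall s, s \in `[t, 0] -> V (v s)).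

Definition ae_eq_on m (a b : R) (v w : R -> 'rV[R]_m) : Prop :=
  {ae lebesgue_measure, forall r : R, r \in `[a, b] -> v r = w r}.

Definition strategy nu nd (t : R) (U : set 'rV[R]_nu) (D : set 'rV[R]_nd)
    (gamma : (R -> 'rV[R]_nu) -> (R -> 'rV[R]_nd)) : Prop :=
  (forall u, signal t U u -> signal t D (gamma u)) /\
  (forall s u u', s \in `[t, 0] -> signal t U u -> signal t U u' ->
    ae_eq_on t s u u' -> ae_eq_on t s (gamma u) (gamma u')).

(* A finite disjoint family of intervals is listed from left to right. *)
Definition abs_continuous n (a b : R) (x : R -> 'rV[R]_n) : Prop :=
  forall e : R, 0 < e -> exists2 delta : R, 0 < delta &
    forall s : seq (R * R),
      all (fun I => [&& a <= I.1, I.1 <= I.2 & I.2 <= b]) s ->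
      pairwise (fun I J => I.2 <= J.1) s ->
      \sum_(I <- s) (I.2 - I.1) < delta ->
      \sum_(I <- s) `|x I.2 - x I.1| < e.

(* Solution in the sense of Caratheodory, as u and d are only measurable. *)
Definition trajectory n nu nd
    (f : 'rV[R]_n -> 'rV[R]_nu -> 'rV[R]_nd -> 'rV[R]_n)
    (t : R) (z : 'rV[R]_n) (u : R -> 'rV[R]_nu) (d : R -> 'rV[R]_nd)
    (zeta : R -> 'rV[R]_n) : Prop :=
  [/\ abs_continuous t 0 zeta,
      zeta t = z &
      {ae lebesgue_measure, forall s : R, s \in `[t, 0] ->
         is_derive s 1 zeta (f (zeta s) (u s) (d s))}].

Definition unique_trajectory n nu nd
    (f : 'rV[R]_n -> 'rV[R]_nu -> 'rV[R]_nd -> 'rV[R]_n)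
    (t : R) (z : 'rV[R]_n) (u : R -> 'rV[R]_nu) (d : R -> 'rV[R]_nd)
    (zeta : R -> 'rV[R]_n) : Prop :=
  trajectory f t z u d zeta /\
  (forall zeta', trajectory f t z u d zeta' -> {in `[t, 0], zeta' =1 zeta}).

(* The trajectory from z is a definite description: it exists, is unique on
   [t, 0], and ends in T. *)
Definition min_brs n nu nd (U : set 'rV[R]_nu) (D : set 'rV[R]_nd)
    (f : 'rV[R]_n -> 'rV[R]_nu -> 'rV[R]_nd -> 'rV[R]_n)
    (T : set 'rV[R]_n) (t : R) : set 'rV[R]_n :=
  [set z | exists2 gamma, strategy t U D gamma &
    forall u, signal t U u ->
      exists2 zeta, unique_trajectory f t z u (gamma u) zeta & T (zeta 0)].

Definition unif_continuous_dyn n nu nd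
    (U : set 'rV[R]_nu) (D : set 'rV[R]_nd)
    (f : 'rV[R]_n -> 'rV[R]_nu -> 'rV[R]_nd -> 'rV[R]_n) : Prop :=
  forall e : R, 0 < e -> exists2 delta : R, 0 < delta &
    forall z z' u u' d d', U u -> U u' -> D d -> D d' ->
      `|z - z'| < delta -> `|u - u'| < delta -> `|d - d'| < delta ->
      `|f z u d - f z' u' d'| < e.

(* Full states are z = (z_1, z_2, z_c), subsystem states are (z_i, z_c). *)
Definition proj1 n1 n2 nc (z : 'rV[R]_(n1 + n2 + nc)) : 'rV[R]_(n1 + nc) :=
  row_mx (lsubmx (lsubmx z)) (rsubmx z).

Definition proj2 n1 n2 nc (z : 'rV[R]_(n1 + n2 + nc)) : 'rV[R]_(n2 + nc) :=
  row_mx (rsubmx (lsubmx z)) (rsubmx z).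

Definition subsystem ni nc nu nd
    (fi : 'rV[R]_ni -> 'rV[R]_nc -> 'rV[R]_nu -> 'rV[R]_nd -> 'rV[R]_ni)
    (fc : 'rV[R]_nc -> 'rV[R]_nu -> 'rV[R]_nd -> 'rV[R]_nc)
    (x : 'rV[R]_(ni + nc)) (u : 'rV[R]_nu) (d : 'rV[R]_nd) : 'rV[R]_(ni + nc) :=
  row_mx (fi (lsubmx x) (rsubmx x) u d) (fc (rsubmx x) u d).

End System.

(* Main.v *)
Require Import Defs.
From HB Require Import structures.
From mathcomp Require Import all_boot all_order all_algebra.
From mathcomp Require Import all_classical all_reals all_analysis.
From mathcomp Require Import measurable_realfun lra.

Set Implicit Arguments.
Unset Strict Implicit.
Unset Printing Implicit Defensive.

Import Order.TTheory GRing.Theory Num.Theory.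
Import numFieldNormedType.Exports.

Local Open Scope classical_set_scope.
Local Open Scope ring_scope.

(** The same strategy gamma serves for the full system and for each subsystem:
    the coordinates of a full trajectory that belong to subsystem i solve
    subsystem i under the same control and disturbance, and the full target is
    contained in the back-projection of the subsystem target.  What needs an
    argument is that the projected trajectory is the only one of the subsystem,
    since membership in [min_brs] asks for this uniqueness.

    A Gronwall estimate is of no use there: the Lipschitz constant of
    [f ^~ u d] may depend on [u] and [d] without any bound, so that along
    measurable signals it need not be integrable.  Uniqueness is transferred
    from the full system instead ([unique_trajectory_colsub]).  Let [y] be a
    second trajectory of the subsystem, seen as a block of coordinates which
    evolves by itself.  Solve the full equation with the block forced to follow
    [y]: the unknown [x] satisfies x' = f (overwrite y x) u d, and
    [overwrite y x] is then a trajectory of the full system from the same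
    initial state.  By uniqueness in the full system it is the given one, hence
    [y] is its projection.  The two subsystems are handled at once by describing
    a block as the columns selected by an injective map [sigma].

    The forced equation has a right-hand side that is bounded, measurable along
    continuous curves, and uniformly continuous in the state uniformly in time,
    so the existence theorem of Caratheodory and Peano applies
    ([caratheodory_peano]).  Its proof is Tonelli's: delaying the state by h > 0
    makes the integral equation explicitly solvable step by step; as h tends
    to 0 the solutions stay uniformly Lipschitz, so that Ascoli's theorem gives
    a locally uniform cluster point, which solves the integral equation and is
    differentiated by means of Lebesgue's theorem.  The measurability of the
    right-hand side is [measurable_fun_unif_continuous]. *)

(** * Row vectors, coordinate by coordinate *)

Section Norm.
Context {R : realType}.

Lemma ler_row_norm n (v : 'rV[R]_n) j : `|v ord0 j| <= `|v|.
Proof.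
rewrite [leRHS]/Num.Def.normr/= mx_normrE.
exact: (le_bigmax _ (fun ij => `|v ij.1 ij.2|) (ord0, j)).
Qed.

Lemma row_norm_le n (v : 'rV[R]_n) e :
  0 <= e -> (forall j, `|v ord0 j| <= e) -> `|v| <= e.
Proof.
move=> e0 ve; rewrite [leLHS]/Num.Def.normr/= mx_normrE bigmax_le//=.
by move=> [i j] _ /=; rewrite ord1.
Qed.

Lemma is_derive_rowP n (x : R -> 'rV[R]_n) (s : R) (v : 'rV[R]_n) :
  is_derive s 1 x v <->
  forall j, is_derive s 1 (fun r => x r ord0 j) (v ord0 j).
Proof.
split=> [[dx xv] j|H].
  have dj := (derivable_mxP x s 1).1 dx ord0 j.
  apply: DeriveDef => //.
  by rewrite -xv derive_mx// mxE.
have dx : derivable x s 1.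
  by apply/derivable_mxP => i j; rewrite ord1; case: (H j).
apply: DeriveDef => //; rewrite derive_mx//.
by apply/rowP => j; rewrite mxE; case: (H j).
Qed.

End Norm.

(** * Measurability of uniformly continuous functions of measurable vectors *)

Section Measurability.
Context d (S : measurableType d) {R : realType}.

(** As [V] is an arbitrary set, [phi] has no reason to be a Borel function.  The
    composition is nevertheless a limit of functions with countably many values:
    cut the space into cubes of side 1/(k+1) and replace [w s] by a point of [V]
    chosen once for all in the cube that contains it. *)
Lemma measurable_fun_unif_continuous m (A : set S) (w : S -> 'rV[R]_m)
    (V : set 'rV[R]_m) (phi : 'rV[R]_m -> R) :
  measurable A ->
  (forall j, measurable_fun A (fun s => w s ord0 j)) ->
  (forall s, A s -> V (w s)) ->
  (forall e : R, 0 < e -> exists2 delta : R, 0 < delta &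
     forall p q, V p -> V q -> `|p - q| < delta -> `|phi p - phi q| < e) ->
  measurable_fun A (phi \o w).
Proof.
move=> mA mw wV phiV.
pose cell k (p : 'rV[R]_m) : 'rV[int]_m :=
  \row_j Num.floor (k.+1%:R * p ord0 j).
pose rep k c := xget 0 [set p | V p /\ cell k p = c].
apply: (@measurable_fun_cvg _ _ _ _ (fun k s => phi (rep k (cell k (w s))))).
- move=> k _ B mB.
  rewrite [X in measurable X](_ : _ = \bigcup_(c in [set: 'rV[int]_m])
     (if `[< B (phi (rep k c)) >] then
       A `&` \bigcap_(j in [set: 'I_m])
         (A `&` (fun s => w s ord0 j) @^-1`
         [set y | Num.floor (k.+1%:R * y) = c ord0 j]) else set0)).
    apply: countable_bigcupT_measurable; first exact: countableP.
    move=> c; case: ifP => // _; apply: measurableI => //.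
    apply: fin_bigcap_measurable => // j _.
    apply: mw => //.
    rewrite [X in measurable X](_ : _ =
      `[(c ord0 j)%:~R / k.+1%:R, (c ord0 j + 1)%:~R / k.+1%:R[%classic)//.
    apply/seteqP; split=> y /=; rewrite in_itv/= ler_pdivrMr// ltr_pdivlMr// (mulrC y).
      by move=> <-; rewrite Num.Theory.floor_le floorD1_gt.
    by move=> H; apply/floor_def.
  apply/seteqP; split=> s /=.
    move=> [As Bs]; exists (cell k (w s)) => //.
    rewrite asboolT//; split => // j _ /=; split => //; by rewrite mxE.
  move=> [c _]; case: asboolP => // Bc [As cs]; split=> //.
  suff -> : cell k (w s) = c by [].
  by apply/rowP => j; rewrite mxE; apply: (cs j I).2.
- move=> s As; apply/cvgrPdist_lt => e /phiV[delta d0 H].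
  near=> k.
  have [Vr cr] : [set p | V p /\ cell k p = cell k (w s)]
      (rep k (cell k (w s))).
    by apply: xgetPex; exists (w s); split=> //; exact: wV.
  apply: H => //; first exact: wV.
  apply: (@le_lt_trans _ _ (k.+1%:R^-1)); last first.
    near: k.
    exact: near_infty_natSinv_lt (PosNum d0).
  apply: row_norm_le => [|j]; first by rewrite invr_ge0.
  move/rowP: cr => /(_ j); rewrite !mxE => cr.
  set x := w s ord0 j in cr *; set y := rep _ _ _ _ in cr *.
  rewrite -(@ler_pM2l _ k.+1%:R)// divff// -[X in X * _]gtr0_norm// -normrM.
  (* Two points of one cube have scaled coordinates with the same floor. *)
  have := Num.Theory.floor_le (k.+1%:R * x); have := floorD1_gt (k.+1%:R * x).
  have := Num.Theory.floor_le (k.+1%:R * y); have := floorD1_gt (k.+1%:R * y).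
  rewrite cr mulrBr intrD ler_norml; lra.
Unshelve. all: by end_near. Qed.

End Measurability.

(** * Primitives of bounded measurable functions *)

Section Integral.
Context {R : realType}.
Notation mu := (@lebesgue_measure R).

Definition primitive (a : R) (phi : R -> R) (s : R) : R :=
  (\int[mu]_(r in `[a, s]) phi r)%R.

Lemma integrable_bounded (phi : R -> R) (M : R) (A : set R) :
  measurable A -> (mu A < +oo)%E ->
  measurable_fun setT phi -> (forall r, `|phi r| <= M) ->
  mu.-integrable A (EFin \o phi).
Proof.
move=> mA fA mphi phiM; apply: measurable_bounded_integrable => //.
  exact: measurable_funTS.
by exists M; split=> [|x Mx r _ /=]; [exact: num_real|exact: le_trans (ltW Mx)].
Qed.

Lemma lebesgue_measure_itv_lty (bb : bool) (a b : R) :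
  (mu [set` Interval (BSide bb a) (BRight b)] < +oo)%E.
Proof.
by rewrite lebesgue_measure_itv/=; case: ifP => // _; rewrite -EFinB ltry.
Qed.

(** The global bound [N] only provides integrability; the estimate uses the bound
    [M] on the interval.  The left end is open or closed because increments of a
    primitive are integrals over half-open intervals. *)
Lemma Rintegral_itv_le_bound (phi : R -> R) (N M a b : R) (bb : bool) :
  a <= b -> measurable_fun setT phi -> (forall r, `|phi r| <= N) ->
  (forall r, r \in `[a, b] -> `|phi r| <= M) ->
  `|(\int[mu]_(r in [set` Interval (BSide bb a) (BRight b)]) phi r)%R|
  <= M * (b - a).
Proof.
move=> ab mphi phiN phiM.
set i := Interval _ _.
have si : [set` i] `<=` `[a, b].
  by move=> x; rewrite /i /= !in_itv/=; case: bb {i} => //= /andP[/ltW -> ->].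
have fi : (mu [set` i] < +oo)%E by exact: lebesgue_measure_itv_lty.
have iphi : mu.-integrable [set` i] (EFin \o phi).
  exact: integrable_bounded phiN.
have icst : mu.-integrable [set` i] (EFin \o cst M).
  by apply: (@integrable_bounded _ `|M|) => // r /=.
apply: (le_trans (le_normr_Rintegral _ iphi)) => //.
apply: (le_trans (le_Rintegral _ _ icst _)) => //.
- exact: integrable_norm.
- by move=> r /si/phiM.
rewrite Rintegral_cst//= lebesgue_measure_itv/= lte_fin.
by case: ltgtP ab => [ab _|//|-> _] /=; rewrite ?mulr0 ?subrr ?mulr0.
Qed.

Lemma primitive_lipschitz (phi : R -> R) (a M r s : R) :
  measurable_fun setT phi -> (forall r, `|phi r| <= M) ->
  `|primitive a phi s - primitive a phi r| <= M * `|s - r|.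
Proof.
move=> mphi phiM.
have M0 : 0 <= M := le_trans (normr_ge0 _) (phiM 0).
wlog rs : r s / r <= s => [H|].
  by have [/H//|/ltW/H] := leP r s; rewrite distrC (distrC r).
rewrite [X in M * X]ger0_norm ?subr_ge0//.
(* The primitive vanishes to the left of its base point a. *)
have [ar|ra] := leP a r.
  rewrite /primitive Rintegral_itvB ?bnd_simp//.
    exact: (@Rintegral_itv_le_bound _ M).
  apply: integrable_bounded => //; exact: lebesgue_measure_itv_lty.
rewrite {2}/primitive set_itv_ge ?bnd_simp -?ltNge// Rintegral_set0 subr0.
have [sa|as_] := ltP s a.
  rewrite /primitive set_itv_ge ?bnd_simp -?ltNge// Rintegral_set0 normr0.
  by rewrite mulr_ge0// subr_ge0.
apply: (le_trans (@Rintegral_itv_le_bound _ M M _ _ _ _ _ _ _)) => //.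
by rewrite ler_wpM2l// lerD2l lerN2 ltW.
Qed.

Lemma primitive_base (phi : R -> R) (a : R) : primitive a phi a = 0.
Proof. by rewrite /primitive set_itv1 Rintegral_set1. Qed.

Lemma primitive_le (phi : R -> R) (a s : R) : s <= a -> primitive a phi s = 0.
Proof.
rewrite le_eqVlt => /predU1P[->|sa]; first exact: primitive_base.
by rewrite /primitive set_itv_ge ?bnd_simp -?ltNge// Rintegral_set0.
Qed.

Lemma eq_primitive (phi psi : R -> R) (a s : R) :
  (forall r, r <= s -> phi r = psi r) -> primitive a phi s = primitive a psi s.
Proof.
move=> E; apply: eq_Rintegral => r; rewrite inE/= in_itv/= => /andP[_ rs].
exact: E.
Qed.

Lemma primitive_close (phi psi : R -> R) (a M e s : R) : a <= s ->
  measurable_fun setT phi -> measurable_fun setT psi ->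
  (forall r, `|phi r| <= M) -> (forall r, `|psi r| <= M) ->
  (forall r, r \in `[a, s] -> `|phi r - psi r| <= e) ->
  `|primitive a phi s - primitive a psi s| <= e * (s - a).
Proof.
move=> as_ mphi mpsi phiM psiM pp.
rewrite /primitive -RintegralB//; last 2 first.
- by apply: integrable_bounded phiM => //; exact: lebesgue_measure_itv_lty.
- by apply: integrable_bounded psiM => //; exact: lebesgue_measure_itv_lty.
apply: (@Rintegral_itv_le_bound _ (M + M)) => //.
  exact: measurable_funB.
by move=> r; rewrite (le_trans (ler_normB _ _))// lerD.
Qed.

Lemma primitive_derive (phi : R -> R) (a M : R) :
  measurable_fun setT phi -> (forall r, `|phi r| <= M) ->
  {ae mu, forall s : R, a < s -> is_derive s (1 : R) (primitive a phi) (phi s)}.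
Proof.
move=> mphi phiM.
have H y : mu.-integrable [set` Interval (BLeft a) (BRight y)] (EFin \o phi).
  by apply: integrable_bounded phiM => //; exact: lebesgue_measure_itv_lty.
have locphi : locally_integrable [set: R] phi.
  split=> //; first exact: openT.
  move=> K _ cK; have mK := compact_measurable cK.
  by have /integrableP[] := integrable_bounded mK (compact_finite_measure cK) mphi phiM.
have := FTC1 H locphi.
apply: filterS; first exact: (ae_filter_ringOfSetsType mu).
move=> s /[swap] as_ /=.
rewrite lte_fin => /(_ as_)[ds <-]; rewrite derive1E.
exact: derivableP.
Qed.

End Integral.

(** * The existence theorem of Caratheodory and Peano *)

Section Peano.
Context {R : realType} (n : nat).
Implicit Types (x y : R -> 'rV[R]_n).

Definition lipschitz_curve (M : R) x :=
  forall r s, `|x s - x r| <= M * `|s - r|.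

Lemma lipschitz_curve_continuous M x : lipschitz_curve M x -> continuous x.
Proof.
move=> xM s; apply/cvgrPdist_lt => e e0.
have M0 : 0 <= `|M| by [].
near=> r; apply: (@le_lt_trans _ _ (`|M| * `|s - r|)).
  by apply: (le_trans (xM _ _)); rewrite ler_wpM2r// ler_norm.
apply: (@le_lt_trans _ _ ((`|M| + 1) * `|s - r|)).
  by rewrite ler_wpM2r// lerDl.
rewrite -ltr_pdivlMl ?ltr_wpDl// mulrC.
near: r; apply: (@cvgr_dist_lt _ _ _ (nbhs s) _ id) => //.
by rewrite divr_gt0// ltr_wpDl.
Unshelve. all: by end_near. Qed.

Context (g : R -> 'rV[R]_n -> 'rV[R]_n) (M : R).
Hypothesis gM : forall s v, `|g s v| <= M.
Hypothesis g_unif : forall e : R, 0 < e -> exists2 delta : R, 0 < delta &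
  forall s v w, `|v - w| < delta -> `|g s v - g s w| < e.
Hypothesis g_meas : forall x, continuous x ->
  forall j, measurable_fun setT (fun s => g s (x s) ord0 j).

Let M0 : 0 <= M. Proof. exact: le_trans (gM 0 0). Qed.

Let gjM x j r : `|g r (x r) ord0 j| <= M.
Proof. exact: le_trans (ler_row_norm _ _) (gM _ _). Qed.

Definition picard (a : R) (v : 'rV[R]_n) x (s : R) : 'rV[R]_n :=
  v + \row_j primitive a (fun r => g r (x r) ord0 j) s.

Lemma picard_lipschitz a v x :
  continuous x -> lipschitz_curve M (picard a v x).
Proof.
move=> cx r s; apply: row_norm_le => [|j]; first by rewrite mulr_ge0.
rewrite !mxE opprD addrACA subrr add0r.
by apply: primitive_lipschitz => //; exact: g_meas.
Qed.

Lemma picard_close a v x y e s : a <= s -> continuous x -> continuous y ->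
  (forall r, r \in `[a, s] -> `|g r (x r) - g r (y r)| <= e) ->
  `|picard a v x s - picard a v y s| <= e * (s - a).
Proof.
move=> as_ cx cy xy.
have e0 : 0 <= e.
  by apply: le_trans (xy a _); rewrite // in_itv/= lexx.
apply: row_norm_le => [|j]; first by rewrite mulr_ge0// subr_ge0.
rewrite !mxE opprD addrACA subrr add0r.
apply: (@primitive_close _ _ _ _ M) => //; [exact: g_meas|exact: g_meas|].
move=> r /xy; apply: le_trans.
by have := ler_row_norm (g r (x r) - g r (y r)) j; rewrite !mxE.
Qed.

(** With the state delayed by [h], the right-hand side on the k-th step of length
    [h] only involves the solution on the previous steps, so one application of
    [picard] extends the solution by one step. *)
Lemma delayed_solution a v (h : R) k : 0 < h -> exists2 x,
  lipschitz_curve M x &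
  forall s, s <= a + k%:R * h -> x s = picard a v (fun r => x (r - h)) s.
Proof.
move=> h0; elim: k => [|k [x xM xE]].
  exists (cst v) => [r s|s]; first by rewrite subrr normr0 mulr_ge0.
  rewrite mul0r addr0 => sa.
  by apply/rowP => j; rewrite !mxE primitive_le// addr0.
have cx : continuous (fun r => x (r - h)).
  apply: (@lipschitz_curve_continuous M) => r s.
  by apply: le_trans (xM _ _) _; rewrite opprB addrA subrK.
exists (picard a v (fun r => x (r - h))); first exact: picard_lipschitz.
move=> s sk; apply/rowP => j; rewrite !mxE; congr (_ + _).
apply: eq_primitive => r rs; congr (g _ _ _ _); apply: xE.
by move: sk; rewrite -natr1; lra.
Qed.

(** On a delayed solution, forgetting the delay moves the state by at most M h,
    which the uniform continuity of [g] turns into a small defect in the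
    integral equation. *)
Lemma approximate_solution a b v (e : R) : 0 < e -> exists x,
  [/\ lipschitz_curve M x, x a = v &
  forall s, s \in `[a, b] -> `|x s - picard a v x s| <= e].
Proof.
move=> e0.
pose e' := e / (1 + `|b - a|).
have e'0 : 0 < e' by rewrite divr_gt0// ltr_pwDl.
have [delta d0 gd] := g_unif e'0.
(* A curve of speed at most M moves by less than delta in time h. *)
pose h := delta / (M + 1).
have h0 : 0 < h by rewrite divr_gt0// ltr_wpDl.
pose k := (Num.truncn ((b - a) / h)).+1.
have [x xM xE] := delayed_solution a v k h0.
have xa : x a = v.
  rewrite xE; last by rewrite lerDl mulr_ge0// ltW.
  by apply/rowP => j; rewrite !mxE primitive_le// addr0.
exists x; split=> // s; rewrite in_itv/= => /andP[as_ sb].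
have cx := lipschitz_curve_continuous xM.
rewrite distrC xE; last first.
  rewrite -lerBlDl (le_trans (_ : _ <= b - a)) ?lerD2r//.
  by rewrite -ler_pdivrMr// ltW// /k truncnS_gt.
apply: (@le_trans _ _ (e' * (s - a))); last first.
  rewrite /e' mulrAC ler_pdivrMr ?ltr_pwDl// ler_pM2l//.
  by have := ler_norm (b - a); lra.
apply: picard_close => //.
  apply: (@lipschitz_curve_continuous M) => r r'.
  by apply: le_trans (xM _ _) _; rewrite opprB addrA subrK.
move=> r _; apply/ltW/gd.
apply: le_lt_trans (xM _ _) _.
rewrite opprB addrC subrK gtr0_norm// /h mulrCA gtr_pMr//.
by rewrite ltr_pdivrMr ?ltr_wpDl// mul1r ltrDl.
Qed.

(** The curves that start at [v] with speed at most [M] form an equicontinuous and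
    pointwise bounded family, so Ascoli's theorem applies.  A cluster point is
    enough for what follows, and it is found without extracting a
    subsequence. *)
Lemma lipschitz_curve_cluster a v (x_ : nat -> R -> 'rV[R]_n) :
  (forall k, lipschitz_curve M (x_ k)) -> (forall k, x_ k a = v) ->
  exists x, forall (e b c : R) N, 0 < e ->
    exists2 k, (N <= k)%N & forall s, s \in `[b, c] -> `|x_ k s - x s| < e.
Proof.
move=> xM xa.
pose W : set {family compact, R -> 'rV[R]_n} :=
  [set x | lipschitz_curve M x /\ x a = v].
have haus : hausdorff_space 'rV[R]_n by exact: norm_hausdorff.
have lc : locally_compact [set: R] by exact: locally_compactR.
have [WP _] := @Ascoli R 'rV[R]_n haus W lc.
have {WP} : precompact W.
  suff /WP[] : pointwise_precompact W id /\ equicontinuous W id by [].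
  split.
    move=> s; pose B : set 'rV[R]_n := [set w | `|w - v| <= M * `|s - a|].
    apply: (@precompact_subset _ _ B).
      by move=> _ [y [yM ya] <-]; rewrite /B/= -ya; exact: yM.
    have cB : closed B.
      rewrite (_ : B = closed_ball_ Num.Def.normr v (M * `|s - a|)); last first.
        by apply/seteqP; split => w; rewrite /B /closed_ball_ /= distrC.
      exact: closed_closed_ball_.
    rewrite precompact_closed//; apply: bounded_closed_compact => //.
    exists (`|v| + M * `|s - a|); split; first exact: num_real.
    move=> r Mr w; rewrite /B/= => wB; apply: ltW; apply: le_lt_trans Mr.
    by rewrite -[w](subrK v) addrC (le_trans (ler_normD _ _))// lerD2l.
  move=> s E; rewrite -entourage_ballE => -[e /= e0 eE].
  near=> r => y [yM _]; apply: eE; rewrite -ball_normE/=.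
  apply: (le_lt_trans (yM _ _)).
  apply: (@le_lt_trans _ _ ((M + 1) * `|s - r|)).
    by rewrite ler_wpM2r// lerDl.
  rewrite -ltr_pdivlMl ?ltr_wpDl// mulrC.
  near: r; apply: (@cvgr_dist_lt _ _ _ (nbhs s) _ id) => //.
  by rewrite divr_gt0// ltr_wpDl.
rewrite precompactE => cW.
have xW k : W (x_ k) by split.
have [|x [_ xcl]] := cW (x_ @ \oo : set_system {family compact, R -> 'rV[R]_n}).
  by exists 0%N => // k _ /=; apply: subset_closure; exact: xW.
exists x => e b c N e0.
have := @fam_nbhs R 'rV[R]_n compact `[b, c] [set p | ball p.1 e p.2] x
  (entourage_ball 'rV[R]_n (PosNum e0)) (@segment_compact R b c).
have Nk : (x_ @ \oo) (x_ @` [set k | (N <= k)%N]).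
  by exists N => // k /= Nk; exists k.
move=> /(xcl _ _ Nk)[_ [[k Nk' <-] H]].
exists k => // s sbc; have := H s sbc; rewrite -ball_normE/= distrC; exact.
Unshelve. all: by end_near. Qed.

(** A cluster point of approximate solutions whose defects tend to 0.  The
    uniform continuity of [g] lets the limit pass under the integral. *)
Lemma integral_solution a b v : exists x,
  [/\ lipschitz_curve M x, x a = v &
  forall s, s \in `[a, b] -> x s = picard a v x s].
Proof.
have /choice[x_ x_P] k : exists x, [/\ lipschitz_curve M x, x a = v &
    forall s, s \in `[a, b] -> `|x s - picard a v x s| <= k.+1%:R^-1].
  exact: approximate_solution.
have x_M k : lipschitz_curve M (x_ k) by have [] := x_P k.
have x_a k : x_ k a = v by have [] := x_P k.
have [x xP] := lipschitz_curve_cluster x_M x_a.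
have xM : lipschitz_curve M x.
  move=> r s; apply/ler_addgt0Pr => e e0.
  have e20 : 0 < e / 2 by rewrite divr_gt0.
  have [k _ kP] := xP (e / 2) (Num.min r s) (Num.max r s) 0%N e20.
  have {}kP q : q \in [:: r; s] -> `|x_ k q - x q| < e / 2.
    by rewrite !inE => /orP[]/eqP->; apply: kP;
      rewrite in_itv/= ge_min le_max lexx ?orbT.
  have kr := kP r (mem_head _ _).
  have ks : `|x_ k s - x s| < e / 2 by apply: kP; rewrite !inE eqxx orbT.
  rewrite -(subrKA (x_ k s)) (le_trans (ler_normD _ _))//.
  rewrite -(subrKA (x_ k r) (x_ k s)) distrC.
  have := x_M k r s; have := ler_normD (x_ k s - x_ k r) (x_ k r - x r).
  lra.
have cx := lipschitz_curve_continuous xM.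
exists x; split=> //.
  apply/eqP; rewrite -subr_eq0 -normr_le0; apply/ler_addgt0Pr => e e0.
  rewrite add0r.
  have [k _ kP] := xP e a a 0%N e0.
  by rewrite distrC -(x_a k) ltW// kP// in_itv/= lexx.
move=> s sab; have := sab; rewrite in_itv/= => /andP[as_ sb].
apply/eqP; rewrite -subr_eq0 -normr_le0; apply/ler_addgt0Pr => e e0.
rewrite add0r.
pose e' := e / (2 + (s - a)).
have d0 : 0 < 2 + (s - a) by rewrite ltr_wpDr// subr_ge0.
have e'0 : 0 < e' by rewrite divr_gt0.
have [delta delta0 gd] := g_unif e'0.
(* The chosen x_k is e'-close to x, and so are the values of g along x_k to
   those along x. *)
have m0 : 0 < Num.min e' delta by rewrite lt_min e'0.
have [N _ /(_ N (leqnn _)) NP] := near_infty_natSinv_lt (PosNum e'0).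
have [k Nk kP] := xP _ a s N m0.
have cxk := lipschitz_curve_continuous (x_M k).
have [_ _ /(_ s sab) k1] := x_P k.
have k2 : `|x_ k s - x s| < e'.
  by have := kP s; rewrite lt_min in_itv/= as_ lexx => /(_ isT)/andP[].
have k3 : `|picard a v (x_ k) s - picard a v x s| <= e' * (s - a).
  apply: picard_close => // r ras.
  by apply/ltW/gd; have := kP r ras; rewrite lt_min => /andP[].
have k4 : k.+1%:R^-1 <= e'.
  apply: (le_trans _ (ltW NP)).
  by rewrite lef_pV2 ?posrE// ler_nat.
have -> : e = e' + (e' + e' * (s - a)).
  by rewrite addrA -mulr2n -mulr_natr -mulrDr divfK// gt_eqF.
rewrite -(subrKA (x_ k s)) (le_trans (ler_normD _ _))// lerD//.
  by rewrite distrC ltW.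
rewrite -(subrKA (picard a v (x_ k) s)) (le_trans (ler_normD _ _))// lerD//.
exact: le_trans k4.
Qed.

(** An integral solution is differentiable at almost every time by Lebesgue's
    differentiation theorem, applied to each coordinate. *)
Theorem caratheodory_peano a b v : exists x,
  [/\ lipschitz_curve M x, x a = v &
  {ae lebesgue_measure, forall s : R, s \in `[a, b] ->
    is_derive s (1 : R) x (g s (x s))}].
Proof.
(* Beyond b, so that the integral equation holds on a neighbourhood of b. *)
have [x [xM xa xE]] := integral_solution a (b + 1) v.
exists x; split=> //.
have cx := lipschitz_curve_continuous xM.
have H j : {ae lebesgue_measure, forall s : R, a < s -> is_derive s (1 : R)
    (primitive a (fun r => g r (x r) ord0 j)) (g s (x s) ord0 j)}.
  by apply: (@primitive_derive _ _ _ M) => //; exact: g_meas.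
have {}H := @filter_forall _ _ _ _ (ae_filter_ringOfSetsType _) H.
have na : {ae lebesgue_measure, forall s : R, s != a}.
  exists [set a]; split=> //; first exact: lebesgue_measure_set1.
  by move=> s /= /negP; rewrite negbK => /eqP.
apply: (@filterS2 _ _ (ae_filter_ringOfSetsType _) _ _ _ _ na H) => s sa Hs sab.
have as_ : a < s.
  by rewrite lt_neqAle eq_sym sa; move: sab; rewrite in_itv/= => /andP[].
apply/is_derive_rowP => j.
have D := Hs j as_.
have {}D := is_deriveD (is_derive_cst (v ord0 j) s (1 : R)) D.
rewrite add0r in D.
apply: near_eq_is_derive D.
have sb : s < b + 1.
  by move: sab; rewrite in_itv/= => /andP[_ sb]; rewrite ltr_pwDr.
near=> r.
rewrite xE ?mxE//= in_itv/=; apply/andP; split; apply/ltW.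
  by near: r; exact: lt_nbhsr.
by near: r; exact: lt_nbhsl.
Unshelve. all: by end_near. Qed.

End Peano.

(** * Absolutely continuous curves *)

Section AbsContinuous.
Context {R : realType} (n : nat).
Implicit Types x : R -> 'rV[R]_n.

Lemma abs_continuous_le_sum m k a b (x : R -> 'rV[R]_m) (y : R -> 'rV[R]_k)
    (z : R -> 'rV[R]_n) :
  abs_continuous a b x -> abs_continuous a b y ->
  (forall r s, `|z s - z r| <= `|x s - x r| + `|y s - y r|) ->
  abs_continuous a b z.
Proof.
move=> xac yac zxy e e0.
have e20 : 0 < e / 2 by rewrite divr_gt0.
have [d1 d10 H1] := xac _ e20; have [d2 d20 H2] := yac _ e20.
exists (Num.min d1 d2) => [|s sab sp]; first by rewrite lt_min d10.
rewrite lt_min => /andP[/(H1 _ sab sp) h1 /(H2 _ sab sp) h2].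
apply: (@le_lt_trans _ _ (\sum_(I <- s) (`|x I.2 - x I.1| + `|y I.2 - y I.1|))).
  exact: ler_sum.
by rewrite big_split/= (splitr e) ltrD.
Qed.

Lemma lipschitz_abs_continuous M a b x :
  lipschitz_curve M x -> abs_continuous a b x.
Proof.
move=> xM e e0; have M10 : 0 < `|M| + 1 by rewrite ltr_wpDl.
exists (e / (`|M| + 1)) => [|s sab _]; first by rewrite divr_gt0.
rewrite ltr_pdivlMr// mulrC; apply: le_lt_trans.
rewrite mulr_sumr big_seq [leRHS]big_seq; apply: ler_sum => I /(allP sab).
move=> /and3P[_ I12 _]; apply: (le_trans (xM _ _)).
rewrite ger0_norm ?subr_ge0// ler_wpM2r ?subr_ge0//.
by rewrite (le_trans (ler_norm _))// lerDl.
Qed.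

Lemma abs_continuous_measurable a b x : abs_continuous a b x ->
  forall j, measurable_fun `[a, b] (fun s => x s ord0 j).
Proof.
move=> xac j; apply: subspace_continuous_measurable_fun => //.
apply/(@subspace_continuousP R `[a, b]%classic) => s sab.
apply/cvgrPdist_lt => e e0.
have [delta delta0 xd] := xac _ e0.
rewrite near_withinE; near=> r => rab.
apply: (@le_lt_trans _ _ `|x s - x r|).
  by have := ler_row_norm (x s - x r) j; rewrite !mxE.
have sr : `|s - r| < delta.
  by near: r; apply: (@cvgr_dist_lt _ _ _ (nbhs s) _ id).
move: sab rab; rewrite /= !in_itv/= => /andP[as_ sb] /andP[ar rb].
have [rs|/ltW rs] := leP r s.
  have := xd [:: (r, s)]; rewrite !big_seq1/=; apply => //.
    by rewrite ar rs sb.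
  by move: sr; rewrite ger0_norm// subr_ge0.
rewrite distrC.
have := xd [:: (s, r)]; rewrite !big_seq1/=; apply => //.
  by rewrite as_ rs rb.
by move: sr; rewrite distrC ger0_norm// subr_ge0.
Unshelve. all: by end_near. Qed.

End AbsContinuous.

(** * Overwriting a block of coordinates *)

Section Block.
Context {R : realType} (n m : nat) (sigma : 'I_m -> 'I_n).

(** The vector [x] in which the coordinates of index [sigma k] have been replaced
    by those of [y]; for an injective [sigma] and a fixed [x] this is a right
    inverse of [colsub sigma]. *)
Definition overwrite (y : 'rV[R]_m) (x : 'rV[R]_n) : 'rV[R]_n :=
  \row_j (if [pick k | sigma k == j] is Some k then y ord0 k else x ord0 j).

Lemma overwrite_outside y x j : (forall k, sigma k != j) ->
  overwrite y x ord0 j = x ord0 j.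
Proof.
by move=> jS; rewrite mxE; case: pickP => // k; rewrite (negPf (jS k)).
Qed.

Lemma overwrite_colsub z : overwrite (colsub sigma z) z = z.
Proof.
by apply/rowP => j; rewrite mxE; case: pickP => // k /eqP <-; rewrite mxE.
Qed.

Lemma overwrite_dist y y' x x' :
  `|overwrite y x - overwrite y' x'| <= `|y - y'| + `|x - x'|.
Proof.
apply: row_norm_le => [|j]; first by rewrite addr_ge0.
rewrite !mxE; case: pickP => [k _|_].
  by have := ler_row_norm (y - y') k; rewrite !mxE => /le_trans; apply; rewrite lerDl.
by have := ler_row_norm (x - x') j; rewrite !mxE => /le_trans; apply; rewrite lerDr.
Qed.

Context (sigma_inj : injective sigma).

Lemma overwrite_inside y x k : overwrite y x ord0 (sigma k) = y ord0 k.
Proof.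
rewrite mxE; case: pickP => [k' /eqP/sigma_inj ->//|/(_ k)].
by rewrite eqxx.
Qed.

Lemma colsub_overwrite y x : colsub sigma (overwrite y x) = y.
Proof. by apply/rowP => k; rewrite mxE overwrite_inside. Qed.

End Block.

(** * Systems with an autonomous block of coordinates *)

Section Autonomous.
Context {R : realType} (n m nu nd : nat) (sigma : 'I_m -> 'I_n).
Context (sigma_inj : injective sigma).
Context (U : set 'rV[R]_nu) (D : set 'rV[R]_nd).
Context (f : 'rV[R]_n -> 'rV[R]_nu -> 'rV[R]_nd -> 'rV[R]_n).
Context (F : 'rV[R]_m -> 'rV[R]_nu -> 'rV[R]_nd -> 'rV[R]_m).
Hypothesis f_unif : unif_continuous_dyn U D f.
Hypothesis f_bounded : [bounded f p.1.1 p.1.2 p.2 | p in setT `*` U `*` D].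
Hypothesis fF : forall z u d, U u -> D d ->
  colsub sigma (f z u d) = F (colsub sigma z) u d.

Lemma trajectory_colsub t z u d zeta :
  signal t U u -> signal t D d -> trajectory f t z u d zeta ->
  trajectory F t (colsub sigma z) u d (fun s => colsub sigma (zeta s)).
Proof.
move=> [_ uU] [_ dD] [zac zt zd]; split.
- apply: (abs_continuous_le_sum zac zac) => r s.
  apply: row_norm_le => [|j]; first by rewrite addr_ge0.
  have := ler_row_norm (zeta s - zeta r) (sigma j); rewrite !mxE => /le_trans.
  by apply; rewrite lerDl.
- by rewrite zt.
- apply: (@filterS _ _ (ae_filter_ringOfSetsType _) _ _ _ zd) => s zs st.
  rewrite -fF; [|exact: uU|exact: dD].
  have /is_derive_rowP zsj := zs st.
  apply/is_derive_rowP => j; rewrite mxE.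
  apply: (@near_eq_is_derive _ _ _ (fun r => zeta r ord0 (sigma j))) => //.
  by near=> r; rewrite mxE.
Unshelve. all: by end_near. Qed.

(** A second trajectory [y] of the block would be completed to a second
    trajectory of the full system: [y] drives the remaining coordinates through
    an equation that has a solution. *)
Lemma unique_trajectory_colsub t z u d zeta :
  signal t U u -> signal t D d -> unique_trajectory f t z u d zeta ->
  unique_trajectory F t (colsub sigma z) u d (fun s => colsub sigma (zeta s)).
Proof.
move=> us ds [zT zU]; split; first exact: trajectory_colsub.
move=> y [yac yt yd].
have [[mu_ uU] [md dD]] := (us, ds).
have [N [_ fN]] := f_bounded.
pose M := `|N| + 1.
have fM w r : r \in `[t, 0] -> `|f w (u r) (d r)| <= M.
  move=> rt; apply: (fN M _ (w, u r, d r)).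
    by rewrite (le_lt_trans (ler_norm _))// ltrDl.
  by split; [split=> //; exact: uU|exact: dD].
(* The forced equation, for an unknown with all n coordinates: those of the
   block are computed too, and then overwritten by y.  The value 0 outside
   [t, 0], where the signals are unconstrained, makes the bounds global. *)
pose g s x := if s \in `[t, 0] then f (overwrite sigma (y s) x) (u s) (d s) else 0.
have gM s x : `|g s x| <= M.
  by rewrite /g; case: ifPn => [|_]; [exact: fM|rewrite normr0 addr_ge0].
have g_unif : forall e : R, 0 < e -> exists2 delta : R, 0 < delta &
    forall s v w, `|v - w| < delta -> `|g s v - g s w| < e.
  move=> e e0; have [delta delta0 fd] := f_unif e0.
  exists delta => // s v w vw; rewrite /g; case: ifPn => st; last by rewrite subrr normr0.
  apply: fd; rewrite ?subrr ?normr0//; [exact: uU|exact: uU|exact: dD|exact: dD|].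
  by apply: le_lt_trans vw; rewrite (le_trans (overwrite_dist _ _ _ _ _))// subrr normr0 add0r.
have g_meas x : continuous x -> forall j, measurable_fun setT (fun s => g s (x s) ord0 j).
  move=> cx j.
  rewrite (_ : (fun _ => _) = (fun s => f (overwrite sigma (y s) (x s)) (u s) (d s) ord0 j)
      \_ `[t, 0]); last first.
    apply/funext => s; rewrite patchE /g mem_setE; case: ifP => // _; by rewrite mxE.
  have m0 : measurable (`[t, 0]%classic : set R) by exact: measurable_itv.
  apply: (@measurable_restrictT _ _ _ _ _ _ m0).1.
  (* State, control and disturbance are gathered into one measurable vector. *)
  pose w s := row_mx (overwrite sigma (y s) (x s)) (row_mx (u s) (d s)).
  pose V : set 'rV[R]_(n + (nu + nd)) :=
    [set p | U (lsubmx (rsubmx p)) /\ D (rsubmx (rsubmx p))].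
  pose phi (p : 'rV[R]_(n + (nu + nd))) :=
    f (lsubmx p) (lsubmx (rsubmx p)) (rsubmx (rsubmx p)) ord0 j.
  rewrite [X in measurable_fun _ X](_ : _ = phi \o w); last first.
    by apply/funext => s; rewrite /phi /w /= !(row_mxKl, row_mxKr).
  apply: (@measurable_fun_unif_continuous _ _ _ _ _ w V) => //.
  - move=> i; case: (split_ordP i) => [i' ->|i' ->].
      rewrite [X in measurable_fun _ X](_ : _ = fun s =>
          if [pick k | sigma k == i'] is Some k then y s ord0 k else x s ord0 i').
        case: pickP => [k _|_]; first exact: (abs_continuous_measurable yac).
        apply: measurable_funTS; apply: continuous_measurable_fun => s.
        exact: (continuous_comp (cx s) (@coord_continuous _ _ _ _ _ _)).
      by apply/funext => s; rewrite /w row_mxEl mxE.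
    case: (split_ordP i') => [k ->|k ->].
      rewrite [X in measurable_fun _ X](_ : _ = fun s => u s ord0 k) //.
      by apply/funext => s; rewrite /w row_mxEr row_mxEl.
    rewrite [X in measurable_fun _ X](_ : _ = fun s => d s ord0 k) //.
    by apply/funext => s; rewrite /w !row_mxEr.
  - by move=> s st; rewrite /V /w /= !(row_mxKl, row_mxKr); split; [exact: uU|exact: dD].
  - move=> e e0; have [delta delta0 fd] := f_unif e0.
    exists delta => // p q [pU pD] [qU qD] pq.
    have le_sub a b (c : 'rV[R]_(a + b)) : `|lsubmx c| <= `|c| /\ `|rsubmx c| <= `|c|.
      by split; apply: row_norm_le => // i; rewrite mxE; exact: ler_row_norm.
    have [p1 p2] := le_sub _ _ (p - q).
    have [p3 p4] := le_sub _ _ (rsubmx (p - q)).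
    apply: le_lt_trans (fd (lsubmx p) (lsubmx q) _ _ _ _ pU qU pD qD _ _ _).
    + have := ler_row_norm (f (lsubmx p) (lsubmx (rsubmx p)) (rsubmx (rsubmx p)) -
        f (lsubmx q) (lsubmx (rsubmx q)) (rsubmx (rsubmx q))) j.
      by rewrite !mxE.
    + by rewrite -linearB (le_lt_trans p1).
    + by rewrite -!linearB (le_lt_trans p3)// (le_lt_trans p2).
    + by rewrite -!linearB (le_lt_trans p4)// (le_lt_trans p2).
have [x [xM xt xd]] := caratheodory_peano gM g_unif g_meas t 0 z.
pose X s := overwrite sigma (y s) (x s).
suff XT : trajectory f t z u d X.
  move=> s st; rewrite -(zU _ XT s st); by rewrite colsub_overwrite.
split.
- have xac : abs_continuous t 0 x by exact: lipschitz_abs_continuous xM.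
  apply: (@abs_continuous_le_sum _ _ _ _ _ _ y x X yac xac) => r s.
  exact: overwrite_dist.
- by rewrite /X yt xt overwrite_colsub.
apply: (@filterS2 _ _ (ae_filter_ringOfSetsType _) _ _ _ _ yd xd) => s ys xs st.
have /is_derive_rowP ysj := ys st; have /is_derive_rowP xsj := xs st.
apply/is_derive_rowP => j.
(* In the block X follows y, which solves the subsystem; outside it follows x. *)
have [k /eqP <-|jS] := pickP (fun k => sigma k == j).
  have -> : f (X s) (u s) (d s) ord0 (sigma k) = F (y s) (u s) (d s) ord0 k.
    rewrite -[y s](colsub_overwrite sigma_inj _ (x s)) -fF ?mxE//.
      exact: uU.
    exact: dD.
  apply: near_eq_is_derive (ysj k).
  by near=> r; rewrite overwrite_inside.
have := xsj j; rewrite /g st; apply: near_eq_is_derive.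
by near=> r; rewrite overwrite_outside// => k; rewrite jS.
Unshelve. all: by end_near. Qed.

Lemma min_brs_colsub (T : set 'rV[R]_n) (T' : set 'rV[R]_m) t :
  T `<=` colsub sigma @^-1` T' ->
  min_brs U D f T t `<=` colsub sigma @^-1` min_brs U D F T' t.
Proof.
move=> TT' z [gamma gammaS gammaT]; exists gamma => // u us.
have [zeta zetaU zetaT] := gammaT u us.
exists (fun s => colsub sigma (zeta s)); last exact: TT'.
exact: unique_trajectory_colsub us (gammaS.1 _ us) zetaU.
Qed.

End Autonomous.

(** * The two subsystems as blocks of coordinates *)

Section Projections.
Context {R : realType} (n1 n2 nc : nat).

Definition sub1_index (k : 'I_(n1 + nc)) : 'I_(n1 + n2 + nc) :=
  match fintype.split k with
  | inl i => lshift nc (lshift n2 i)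
  | inr j => rshift (n1 + n2) j
  end.

Definition sub2_index (k : 'I_(n2 + nc)) : 'I_(n1 + n2 + nc) :=
  match fintype.split k with
  | inl i => lshift nc (rshift n1 i)
  | inr j => rshift (n1 + n2) j
  end.

Lemma sub1_index_inj : injective sub1_index.
Proof.
move=> k l; rewrite /sub1_index.
case: split_ordP => i ->; case: split_ordP => j -> /eqP;
  by rewrite !(eq_lshift, eq_rshift, eq_lrshift, eq_rlshift) => // /eqP ->.
Qed.

Lemma sub2_index_inj : injective sub2_index.
Proof.
move=> k l; rewrite /sub2_index.
case: split_ordP => i ->; case: split_ordP => j -> /eqP;
  by rewrite !(eq_lshift, eq_rshift, eq_lrshift, eq_rlshift) => // /eqP ->.
Qed.

Lemma proj1E : @proj1 R n1 n2 nc = colsub sub1_index.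
Proof.
apply/funext => z; apply/rowP => k; rewrite !mxE /sub1_index.
by case: split_ordP => i _; rewrite !mxE.
Qed.

Lemma proj2E : @proj2 R n1 n2 nc = colsub sub2_index.
Proof.
apply/funext => z; apply/rowP => k; rewrite !mxE /sub2_index.
by case: split_ordP => i _; rewrite !mxE.
Qed.

End Projections.

Theorem corollary4 (R : realType) (n1 n2 nc nu nd : nat)
  (hn1 : (0 < n1)%N) (hn2 : (0 < n2)%N)
  (U : set 'rV[R]_nu) (D : set 'rV[R]_nd)
  (hU : compact U) (hD : bounded_set D)
  (f : 'rV[R]_(n1 + n2 + nc) -> 'rV[R]_nu -> 'rV[R]_nd ->
       'rV[R]_(n1 + n2 + nc))
  (hf_unif : unif_continuous_dyn U D f)
  (hf_bounded : [bounded f p.1.1 p.1.2 p.2 | p in setT `*` U `*` D])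
  (hf_lipschitz : forall u d, U u -> D d ->
     [lipschitz f z u d | z in setT])
  (f1 : 'rV[R]_n1 -> 'rV[R]_nc -> 'rV[R]_nu -> 'rV[R]_nd -> 'rV[R]_n1)
  (f2 : 'rV[R]_n2 -> 'rV[R]_nc -> 'rV[R]_nu -> 'rV[R]_nd -> 'rV[R]_n2)
  (fc : 'rV[R]_nc -> 'rV[R]_nu -> 'rV[R]_nd -> 'rV[R]_nc)
  (hf_decomp : forall z1 z2 zc u d, U u -> D d ->
     f (row_mx (row_mx z1 z2) zc) u d =
     row_mx (row_mx (f1 z1 zc u d) (f2 z2 zc u d)) (fc zc u d))
  (t : R) (ht : t < 0)
  (T : set 'rV[R]_(n1 + n2 + nc))
  (T1 : set 'rV[R]_(n1 + nc)) (T2 : set 'rV[R]_(n2 + nc))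
  (hT : T = (@proj1 R n1 n2 nc @^-1` T1) `&` (@proj2 R n1 n2 nc @^-1` T2)) :
  min_brs U D f T t `<=`
    (@proj1 R n1 n2 nc @^-1` min_brs U D (subsystem f1 fc) T1 t) `&`
    (@proj2 R n1 n2 nc @^-1` min_brs U D (subsystem f2 fc) T2 t).
Proof.
have proj_row z1 z2 (zc : 'rV[R]_nc) :
    (@proj1 R n1 n2 nc (row_mx (row_mx z1 z2) zc) = row_mx z1 zc) *
    (@proj2 R n1 n2 nc (row_mx (row_mx z1 z2) zc) = row_mx z2 zc).
  by rewrite /proj1 /proj2 !(row_mxKl, row_mxKr).
have fE z u d : U u -> D d ->
    (proj1 (f z u d) = subsystem f1 fc (proj1 z) u d) *
    (proj2 (f z u d) = subsystem f2 fc (proj2 z) u d).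
  move=> Uu Dd; rewrite -[z]hsubmxK -[lsubmx z]hsubmxK hf_decomp// !proj_row.
  by rewrite /subsystem !(row_mxKl, row_mxKr).
move=> z zA; split.
- rewrite proj1E; move: z zA.
  apply: (min_brs_colsub (@sub1_index_inj _ _ _) hf_unif hf_bounded).
    by move=> z u d Uu Dd; rewrite -proj1E (fE z u d Uu Dd).
  by rewrite -proj1E hT => z [].
- rewrite proj2E; move: z zA.
  apply: (min_brs_colsub (@sub2_index_inj _ _ _) hf_unif hf_bounded).
    by move=> z u d Uu Dd; rewrite -proj2E (fE z u d Uu Dd).
  by rewrite -proj2E hT => z [].
Qed.
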